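(* Let $\mu$ be a Borel probability measure on a compact topological space $\Omega$ and let $V_n\subset C(\Omega)$ be an $n$-dimensional subspace of the space of continuous complex-valued functions on $\Omega$. Then there exist an $N\le 2n$, points $x_1,\dots,x_{N+1}\in\Omega$ and non-negative weights $\mu_1,\dots,\mu_{N+1}$ satisfying $\mu_1+\dots+\mu_{N+1}=1$ such that $$\int_\Omega f(x)\,\mathrm d\mu(x)=\sum_{i=1}^{N+1}\mu_i f(x_i)\quad\text{for all } f\in V_n .$$
   Context: $C(\Omega)$ is the space of continuous complex-valued functions on $\Omega$; dimension is over $\mathbb{C}$. *)

(* Defs.v *)
From HB Require Import structures.
From mathcomp Require Import all_boot all_order all_algebra.
From mathcomp Require Import all_classical all_reals all_analysis.
From mathcomp Require Import complex.

Set Implicit Arguments.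
Unset Strict Implicit.
Unset Printing Implicit Defensive.

Import Order.TTheory GRing.Theory Num.Theory.
Import numFieldNormedType.Exports.

Local Open Scope classical_set_scope.
Local Open Scope ring_scope.
Local Open Scope complex_scope.

(* [measurableType] requires a distinguished point, whence [ptopologicalType];
   this excludes only the empty space, which carries no probability measure. *)
Notation borelType T := (g_sigma_algebraType (@open T)).

(* The regular module [R[i]^o] is the alias of [R[i]] on which the library puts
   the topology of the modulus and the structure of a module over [R[i]]. *)
Definition continuous_space (R : realType) (T : topologicalType) :
    set (T -> R[i]^o) :=
  [set f | continuous f].
Arguments continuous_space : clear implicits.

Definition is_subspace (K : fieldType) (E : lmodType K) (V : set E) : Prop :=
  V 0 /\ forall (a : K) (u v : E), V u -> V v -> V (a *: u + v).

Definition is_basis (K : fieldType) (E : lmodType K) (V : set E) (n : nat)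
    (b : 'I_n -> E) : Prop :=
  [/\ forall i, V (b i),
      forall c : 'I_n -> K, \sum_(i < n) c i *: b i = 0 -> forall i, c i = 0
    & forall v, V v -> exists c : 'I_n -> K, v = \sum_(i < n) c i *: b i].

Definition has_dimension (K : fieldType) (E : lmodType K) (V : set E)
    (n : nat) : Prop :=
  exists b : 'I_n -> E, is_basis V b.

(* As for [Rintegral], this is the integral of [f] when both [Re f] and [Im f]
   are integrable, which holds for continuous [f] on a compact space with a
   finite Borel measure. *)
Definition Cintegral d (T : measurableType d) (R : realType)
    (mu : {measure set T -> \bar R}) (f : T -> R[i]) : R[i] :=
  (\int[mu]_x complex.Re (f x)) +i* (\int[mu]_x complex.Im (f x)).

(* Main.v *)
Require Import Defs.
From mathcomp Require Import all_boot all_order all_algebra.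
From mathcomp Require Import all_classical all_reals all_analysis.
From mathcomp Require Import complex ring lra.

Set Implicit Arguments.
Unset Strict Implicit.
Unset Printing Implicit Defensive.

Import Order.TTheory GRing.Theory Num.Theory.
Import numFieldNormedType.Exports.

Local Open Scope classical_set_scope.
Local Open Scope ring_scope.
Local Open Scope complex_scope.

(* Quadrature rules with m + 1 nodes and weights in the simplex form a compact
   space, so some rule minimizes the squared distance to the vector of the
   integrals of m real continuous functions. If the minimum were positive, with
   defect vector d, some point of Omega would give d . g a value at least its
   integral; moving mass towards that point decreases the distance, at the cost
   of one more node, which Caratheodory's reduction then removes. In the complex
   case take the m = 2 n real and imaginary parts of a basis. *)

(** * Linear algebra of Caratheodory's reduction *)

Lemma affine_dependence (F : fieldType) (m : nat) (y : 'I_m.+2 -> 'I_m -> F) :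
  exists c : 'I_m.+2 -> F, [/\ exists i, c i != 0, \sum_i c i = 0
    & forall j, \sum_i c i * y i j = 0].
Proof.
(* Column [ord0] of ones encodes the vanishing sum of coefficients. With m + 2 rows and m + 1
   columns, [A] has a nonzero left kernel. *)
pose A := \matrix_(i < m.+2, j < m.+1)
  (if unlift ord0 j is Some k then y i k else 1).
have : kermx A != 0.
  by rewrite kermx_eq0 /row_free neq_ltn ltnS rank_leq_col.
case/rowV0Pn => v /sub_kermxP vA v0; exists (v 0); split.
- apply/existsP; apply: contra_neqT v0; rewrite negb_exists => /forallP v0.
  by apply/rowP => i; rewrite mxE; apply/eqP; rewrite -[_ == _]negbK.
- move/rowP/(_ ord0): vA; rewrite !mxE; apply: etrans; apply: eq_bigr => i _.
  by rewrite !mxE unlift_none mulr1.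
- move=> j; move/rowP/(_ (lift ord0 j)): vA; rewrite !mxE; apply: etrans.
  by apply: eq_bigr => i _; rewrite !mxE liftK.
Qed.

(* Subtract from the weights the largest multiple of an affine dependence that
   keeps them nonnegative. *)
Lemma caratheodory_step (F : realFieldType) (m : nat)
    (y : 'I_m.+2 -> 'I_m -> F) (w : 'I_m.+2 -> F) :
  (forall i, 0 <= w i) ->
  exists i0 (w' : 'I_m.+2 -> F), [/\ forall i, 0 <= w' i, w' i0 = 0,
    \sum_i w' i = \sum_i w i
    & forall j, \sum_i w' i * y i j = \sum_i w i * y i j].
Proof.
move=> w_ge0; have [c [[k ck0] sumc sumcy]] := affine_dependence y.
have [i1 ci1] : exists i, 0 < c i.
  apply/existsP; apply: contraNT ck0; rewrite negb_exists => /forallP c_le0.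
  have : \sum_i - c i = 0 by rewrite sumrN sumc oppr0.
  move/psumr_eq0P => sum0; rewrite -oppr_eq0 sum0 // => i _.
  by rewrite oppr_ge0 leNgt.
have [i0 ci0 i0min] :=
  arg_minP (P := [pred i | 0 < c i]) (fun i => w i / c i) ci1.
pose t := w i0 / c i0; have t_ge0 : 0 <= t by rewrite divr_ge0 ?w_ge0 // ltW.
exists i0, (fun i => w i - t * c i); split.
- move=> i; rewrite subr_ge0; have [ci|ci] := ltP 0 (c i).
    by rewrite -ler_pdivlMr // i0min.
  by rewrite (le_trans _ (w_ge0 i)) // mulr_ge0_le0.
- by rewrite /t divfK ?subrr // gt_eqF.
- by rewrite sumrB -mulr_sumr sumc mulr0 subr0.
- move=> j; under eq_bigr do rewrite mulrBl -mulrA.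
  by rewrite sumrB -mulr_sumr sumcy mulr0 subr0.
Qed.

(** * Continuity and integration of the test functions *)

Lemma nonexpansive_continuous (R : realType) (f : R[i]^o -> R) :
  (forall z u : R[i]^o, `|f z - f u|%:C <= `|z - u|) -> continuous f.
Proof.
move=> f_le z.
have Fz : Filter (nbhs z) := nbhs_filter z.
apply/(@cvgrPdist_le R R R[i]^o (nbhs z) Fz) => e e0.
have e0' : 0 < e%:C by rewrite ltcR.
have := @cvgr_dist_le _ R[i]^o _ (nbhs z) Fz id z cvg_id _ e0'.
apply: (@filterS _ _ Fz) => u /(le_trans (f_le z u)).
by rewrite lecR.
Qed.

Lemma Re_continuous (R : realType) :
  continuous (@complex.Re R : R[i]^o -> R).
Proof.
by apply: nonexpansive_continuous => z u; rewrite -raddfB normc_ge_Re.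
Qed.

Lemma Im_continuous (R : realType) :
  continuous (@complex.Im R : R[i]^o -> R).
Proof.
(* Reduction to the real part: - Im z = Re (z 'i), and 'i has modulus 1. *)
apply: nonexpansive_continuous => z u; rewrite -raddfB -normrN -ReiNIm.
by rewrite (le_trans (normc_ge_Re _)) // normrM complexiE normCi mulr1.
Qed.

Lemma continuous_borel_measurable (R : realType) (T : ptopologicalType)
    (f : T -> R) :
  continuous f -> measurable_fun [set: borelType T] (f : borelType T -> R).
Proof.
move=> /continuousP cf.
apply: (measurability _ (measurable_realfun.RGenOpens.measurableE R)).
move=> _ [_ [a [b ->]] <-]; rewrite setTI; apply: sub_sigma_algebra.
exact/cf/interval_open.
Qed.

Section compact_borel.
Context (R : realType) (T : ptopologicalType).
Context (mu : probability (borelType T) R).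
Context (cT : compact [set: T]).

Lemma continuous_borel_integrable (f : T -> R) :
  continuous f -> mu.-integrable [set: borelType T] (EFin \o f).
Proof.
move=> cf; apply: (@measurable_bounded_integrable _ (borelType T)) => //.
- by rewrite [X in (X < _)%E]probability_setT ltry.
- exact: continuous_borel_measurable.
have [M [Mreal fM]] :=
  compact_bounded (continuous_compact (continuous_subspaceT cf) cT).
by exists M; split=> // N /fM fN x _; apply: fN; exact: imageP.
Qed.

Lemma Rintegral_lincomb (m : nat) (g : 'I_m -> T -> R) (d : 'I_m -> R) :
  (forall j, continuous (g j)) ->
  \int[mu]_x (\sum_j d j * g j x) = \sum_j d j * \int[mu]_x g j x.
Proof.
move=> cg; have mT : measurable [set: borelType T] by [].
have cdg j : continuous (fun x => d j * g j x).
  by move=> x; apply: cvgM; [exact: cvg_cst|exact: cg].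
elim: (index_enum _) => [|j s IH].
  under [LHS]eq_Rintegral do rewrite big_nil.
  by rewrite big_nil Rintegral_cst // mul0r.
under [LHS]eq_Rintegral do rewrite big_cons.
rewrite big_cons RintegralD //; last 2 first.
- exact: continuous_borel_integrable.
- apply: continuous_borel_integrable; apply: continuous_big => //.
  exact: add_continuous.
by rewrite IH RintegralZl //; exact: continuous_borel_integrable.
Qed.

(** A maximum point of [f] works, because [mu] has total mass 1. This will supply the new node. *)
Lemma Rintegral_le_value (f : T -> R) :
  continuous f -> exists x, \int[mu]_x f x <= f x.
Proof.
move=> cf.
have [|x _ xmax] := compact_EVT_max _ cT (continuous_subspaceT cf).
  by exists point.
exists x; have -> : f x = \int[mu]_(_ in [set: borelType T]) f x.
  by rewrite Rintegral_cst // [X in fine X]probability_setT mulr1.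
apply: le_Rintegral => //.
- exact: continuous_borel_integrable.
- exact: (continuous_borel_integrable (@cst_continuous _ _ (f x))).
- by move=> y _; apply: xmax; rewrite inE.
Qed.

End compact_borel.

(** Here [d] is the defect and [e] the direction in which the quadrature vector moves. The
    hypothesis makes the angle between them acute enough for a step of length at most 1 to bring it
    closer to the target. *)
Lemma min_distance_decrease (F : realFieldType) (m : nat) (d e : 'I_m -> F) :
  0 < \sum_j d j ^+ 2 -> \sum_j d j ^+ 2 <= \sum_j d j * e j ->
  exists t, [/\ 0 <= t, t <= 1
    & \sum_j (d j - t * e j) ^+ 2 < \sum_j d j ^+ 2].
Proof.
set D := \sum_j d j ^+ 2; move=> D_gt0 de.
pose Q := \sum_j e j ^+ 2.
have Q_ge0 : 0 <= Q by apply: sumr_ge0 => j _; exact: sqr_ge0.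
have DQ_gt0 : 0 < D + Q by rewrite ltr_pwDl.
(* The term D in the denominator keeps t at most 1 and gives t Q = D - t D < D, so that 2 d . e - t
   Q > D > 0. *)
pose t := D / (D + Q); have tDQ : t * (D + Q) = D by rewrite divfK // gt_eqF.
have t_gt0 : 0 < t by rewrite divr_gt0.
exists t; split; first exact: ltW.
  by rewrite ler_pdivrMr // mul1r lerDl.
have -> : \sum_j (d j - t * e j) ^+ 2 =
    D - t * (2 * \sum_j d j * e j - t * Q).
  rewrite /D /Q mulrBr !mulr_sumr -sumrB -sumrB.
  by apply: eq_bigr => j _; ring.
rewrite gtrDl oppr_lt0 mulr_gt0 //; nra.
Qed.

(** * Minimizing the defect over all quadrature rules *)

Section quadrature.
Context (R : realType) (T : ptopologicalType).
Context (mu : probability (borelType T) R).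
Context (cT : compact [set: T]).
Context (m : nat) (g : 'I_m -> T -> R).
Context (cg : forall j, continuous (g j)).

Let node := (R * T)%type.
Let rule := prod_topology (fun _ : 'I_m.+1 => node).
Let defect (p : rule) (j : 'I_m) : R :=
  \int[mu]_x g j x - \sum_i (p i).1 * g j (p i).2.
(** Bounding the weights by 1 follows from the sum condition, but it exhibits the set as a closed
    part of a product of compact sets, to which Tychonoff's theorem applies. *)
Let rules : set rule :=
  [set p | forall i, (`[0, 1]%classic `*` [set: T]) (p i)] `&`
  [set p | \sum_i (p i).1 = 1].

Let weight_continuous i : continuous (fun p : rule => (p i).1).
Proof.
move=> p; apply: (@cvg_comp _ _ _ (fun p : rule => p i) fst).
  exact: (@proj_continuous _ (fun _ : 'I_m.+1 => node) i).
exact: cvg_fst.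
Qed.

Let node_continuous i : continuous (fun p : rule => (p i).2).
Proof.
move=> p; apply: (@cvg_comp _ _ _ (fun p : rule => p i) snd).
  exact: (@proj_continuous _ (fun _ : 'I_m.+1 => node) i).
exact: cvg_snd.
Qed.

Let compact_rules : compact rules.
Proof.
apply: compact_closedI.
  apply: (@tychonoff _ (fun _ : 'I_m.+1 => node)
    (fun _ => `[0, 1]%classic `*` [set: T])) => i.
  by apply: compact_setX cT; exact: segment_compact.
apply: (@preimage_closed _ _ (fun p : rule => \sum_i (p i).1) [set 1]).
  move=> p _; move: p; apply: continuous_big; first exact: add_continuous.
  by move=> i _; exact: weight_continuous.
exact: closed_eq.
Qed.

Let sqr_defect_continuous :
  continuous (fun p : rule => \sum_j defect p j ^+ 2).
Proof.
apply: continuous_big; first exact: add_continuous.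
move=> j _ p.
have cquad : continuous (fun p : rule => \sum_i (p i).1 * g j (p i).2).
  apply: continuous_big; first exact: add_continuous.
  move=> i _ q; apply: (cvgM (weight_continuous (i := i) (x := q))).
  apply: (@cvg_comp _ _ _ (fun p : rule => (p i).2) (g j)).
    exact: (node_continuous (i := i) (x := q)).
  exact: cg.
apply: (@cvg_comp _ _ _ (defect ^~ j) (fun r : R => r ^+ 2)).
  exact: (cvgB (cvg_cst (\int[mu]_x g j x)) (cquad p)).
exact: exprn_continuous.
Qed.

Lemma compact_quadrature :
  exists (x : 'I_m.+1 -> T) (w : 'I_m.+1 -> R),
    [/\ forall i, 0 <= w i, \sum_i w i = 1
      & forall j, \int[mu]_x g j x = \sum_i w i * g j (x i)].
Proof.
have [|p /set_mem [p01 p1] pmin] :=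
    compact_EVT_min _ compact_rules (continuous_subspaceT sqr_defect_continuous).
  (* Some rule exists: all the mass on one node. *)
  exists (fun i => ((i == ord0)%:R, point)); split.
    by move=> i; split=> //=; rewrite in_itv /=; case: eqP; rewrite ?lexx ?ler01.
  by rewrite /= (bigD1 ord0) //= big1 ?addr0 // => i /negbTE ->.
have p_ge0 i : 0 <= (p i).1.
  by have [/=] := p01 i; rewrite in_itv /= => /andP[].
pose D := \sum_j defect p j ^+ 2.
have D_ge0 : 0 <= D by apply: sumr_ge0 => j _; exact: sqr_ge0.
have [D0|D_neq0] := eqVneq D 0.
  exists (fun i => (p i).2), (fun i => (p i).1); split => // j.
  have /(_ j isT)/eqP := psumr_eq0P (fun j _ => sqr_ge0 (defect p j)) D0.
  by rewrite sqrf_eq0 subr_eq0 => /eqP.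
have D_gt0 : 0 < D by rewrite lt_def D_neq0.
have [x0] : exists x, \int[mu]_x (\sum_j defect p j * g j x) <=
    \sum_j defect p j * g j x.
  apply: Rintegral_le_value => //.
  apply: continuous_big; first exact: add_continuous.
  by move=> j _ x; apply: cvgM; [exact: cvg_cst|exact: cg].
rewrite Rintegral_lincomb // => x0le.
pose quad j := \sum_i (p i).1 * g j (p i).2.
have [|t [t_ge0 t_le1 tD]] :=
    @min_distance_decrease _ _ (defect p) (fun j => g j x0 - quad j) D_gt0.
  (* Since the integral of [g j] is [defect p j + quad j], the required bound is [x0le]
     rearranged. *)
  under [leRHS]eq_bigr do rewrite mulrBr.
  rewrite sumrB lerBrDr; apply: le_trans x0le; rewrite -big_split /=.
  by apply: ler_sum => j _; rewrite expr2 -mulrDr subrK.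
(* The moved rule has m + 2 nodes: [x0] with weight t at index [ord0], then the nodes of [p] with
   weights scaled by 1 - t. *)
pose x i := if unlift ord0 i is Some k then (p k).2 else x0.
pose w i := if unlift ord0 i is Some k then (1 - t) * (p k).1 else t.
have w_ge0 i : 0 <= w i.
  by rewrite /w; case: unliftP => // k _; rewrite mulr_ge0 // subr_ge0.
have sumE (F : R -> T -> R) : \sum_i F (w i) (x i) =
    F t x0 + \sum_i F ((1 - t) * (p i).1) (p i).2.
  rewrite big_ord_recl /w /x unlift_none; congr (_ + _).
  by apply: eq_bigr => i _; rewrite liftK.
have [i0 [w' [w'_ge0 w'0 sumw' quadw']]] :=
  caratheodory_step (fun i j => g j (x i)) w_ge0.
have sumw'1 : \sum_(i < m.+1) w' (lift i0 i) = 1.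
  have := sumw'; rewrite (bigD1_ord i0) //= w'0 add0r => ->.
  by rewrite (sumE (fun r _ => r)) -mulr_sumr p1 mulr1 subrKC.
(* Dropping [i0], whose new weight is 0, leaves m + 1 nodes. *)
pose p' : rule := fun i => (w' (lift i0 i), x (lift i0 i)).
have p'_rule : rules p'.
  split=> // i; split=> //=; rewrite in_itv /= w'_ge0 -sumw'1 /=.
  by rewrite (bigD1 i) //= lerDl sumr_ge0.
have := pmin p' (mem_set p'_rule); rewrite leNgt => /negP[].
(* The defect of [p'] is [defect p j - t * (g j x0 - quad j)], so [tD] contradicts the minimality of
   [p]. *)
congr (_ < _): tD; apply: eq_bigr => j _; congr (_ ^+ 2).
have quad' : \sum_i (p' i).1 * g j (p' i).2 = t * g j x0 + (1 - t) * quad j.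
  have := quadw' j; rewrite (bigD1_ord i0) //= w'0 mul0r add0r => ->.
  rewrite (sumE (fun r y => r * g j y)) mulr_sumr; congr (_ + _).
  by apply: eq_bigr => i _; rewrite mulrA.
rewrite /defect quad' -/(quad j); ring.
Qed.

End quadrature.

(** * From n complex functions to 2 n real ones *)

Definition cat_family (A : Type) (n : nat) (u v : 'I_n -> A) (j : 'I_(n + n)) :
    A :=
  match fintype.split j with inl i => u i | inr i => v i end.

Lemma sum_cat_familyM (F : pzSemiRingType) (n : nat) (u v u' v' : 'I_n -> F) :
  \sum_j cat_family u v j * cat_family u' v' j =
  \sum_i (u i * u' i + v i * v' i).
Proof.
rewrite big_split_ord big_split /cat_family; congr (_ + _).
  by apply: eq_bigr => i _; rewrite (unsplitK (inl i)).
by apply: eq_bigr => i _; rewrite (unsplitK (inr i)).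
Qed.

Definition ReIm (R : realType) (n : nat) (z : 'I_n -> R[i]) :
    'I_(n + n) -> R :=
  cat_family (fun i => complex.Re (z i)) (fun i => complex.Im (z i)).

(** The real coefficients depend on [c] alone, so when [z] varies with the point of the space,
    exactness on the 2 n real coordinates carries over to the real part of the combination. *)
Lemma Re_lincomb (R : realType) (n : nat) (c z : 'I_n -> R[i]) :
  complex.Re (\sum_i c i * z i) =
  \sum_j cat_family (fun i => complex.Re (c i)) (fun i => - complex.Im (c i)) j *
    ReIm z j.
Proof.
rewrite sum_cat_familyM raddf_sum; apply: eq_bigr => i _ /=.
by case: (c i) (z i) => [a b] [u v] /=; rewrite mulNr.
Qed.

Lemma Im_lincomb (R : realType) (n : nat) (c z : 'I_n -> R[i]) :
  complex.Im (\sum_i c i * z i) =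
  \sum_j cat_family (fun i => complex.Im (c i)) (fun i => complex.Re (c i)) j *
    ReIm z j.
Proof.
rewrite sum_cat_familyM raddf_sum; apply: eq_bigr => i _ /=.
by case: (c i) (z i) => [a b] [u v] /=; rewrite addrC.
Qed.

Theorem theorem4p3 (R : realType) (Omega : ptopologicalType)
    (mu : probability (borelType Omega) R)
    (n : nat) (V : set (Omega -> R[i]^o)) :
  compact [set: Omega] ->
  V `<=` continuous_space R Omega ->
  is_subspace V ->
  has_dimension V n ->
  exists N : nat, (N <= 2 * n)%N /\
    exists (x : 'I_N.+1 -> Omega) (w : 'I_N.+1 -> R),
      [/\ forall i, 0 <= w i,
          \sum_(i < N.+1) w i = 1
        & forall f, V f ->
            Cintegral mu f = \sum_(i < N.+1) (w i)%:C * f (x i)].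

Proof.
move=> cO VC _ [b [Vb _ Vspan]].
pose g (j : 'I_(n + n)) (x : Omega) : R := ReIm (b ^~ x) j.
have cg j : continuous (g j).
  rewrite /g /ReIm /cat_family; case: (fintype.split j) => i x.
    apply: (@cvg_comp _ _ _ (b i) (@complex.Re R : R[i]^o -> R)).
      exact: VC (Vb i) x.
    exact: Re_continuous.
  apply: (@cvg_comp _ _ _ (b i) (@complex.Im R : R[i]^o -> R)).
    exact: VC (Vb i) x.
  exact: Im_continuous.
have [x [w [w_ge0 w1 quad]]] := compact_quadrature mu cO cg.
exists (n + n)%N; split; first by rewrite mul2n addnn.
exists x, w; split=> // _ /Vspan[c ->].
(* Exactness passes from the [g j] to their real combinations, hence to the real and imaginary parts
   of every member of [V]. *)
have lincomb_quad (h : Omega -> R) (d : 'I_(n + n) -> R) :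
    (forall y, h y = \sum_j d j * g j y) ->
    \int[mu]_y h y = \sum_i w i * h (x i).
  move=> hE; under eq_Rintegral do rewrite hE.
  rewrite Rintegral_lincomb //.
  under [RHS]eq_bigr do rewrite hE mulr_sumr.
  rewrite exchange_big /=; apply: eq_bigr => j _.
  by rewrite quad mulr_sumr; apply: eq_bigr => i _; rewrite mulrCA.
pose f y := \sum_i c i * b i y.
have -> : \sum_i c i *: b i = f by apply/funext => y; rewrite fct_sumE.
have quad_Re :=
  lincomb_quad (fun y => complex.Re (f y)) _ (fun y => Re_lincomb c (b ^~ y)).
have quad_Im :=
  lincomb_quad (fun y => complex.Im (f y)) _ (fun y => Im_lincomb c (b ^~ y)).
clearbody f.
rewrite /Cintegral quad_Re quad_Im.
apply/eqP; rewrite eq_complex !raddf_sum; apply/andP; split; apply/eqP.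
  by apply: eq_bigr => i _ /=; case: (f (x i)) => u v /=; rewrite mul0r subr0.
by apply: eq_bigr => i _ /=; case: (f (x i)) => u v /=; rewrite mul0r addr0.
Qed.
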